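(* Let $d \in \mathbb{N}$ and let $G$ be a (nonempty) subgraph of $Q_n$ with average degree at least $d$. Then $G$ contains at least $\frac{d!\,|V(G)|}{2}$ geodesics of length $d$.
   Context: The hypercube $Q_n$ has vertex set $\{0,1\}^n$, two vertices adjacent iff they differ in exactly one coordinate; the direction of an edge is that coordinate. A path in $Q_n$ is a geodesic if no two of its edges have the same direction; length means number of edges. Geodesics are counted as paths (subgraphs), i.e. a path and its reversal are counted once. The average degree of $G$ is $2|E(G)|/|V(G)|$. *)

(* Defs.v *)
From mathcomp Require Import all_boot.
Set Implicit Arguments. Unset Strict Implicit. Unset Printing Implicit Defensive.

Definition cube (n : nat) := {ffun 'I_n -> bool}.

Definition diffset n (u v : cube n) : {set 'I_n} := [set i | u i != v i].

Definition qadj n (u v : cube n) : bool := #|diffset u v| == 1.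

Definition is_subgraph n (VG : {set cube n}) (EG : {set {set cube n}}) : Prop :=
  forall e, e \in EG -> exists u v,
    [/\ u \in VG, v \in VG, qadj u v & e = [set u; v]].

(* A walk t = v_0 ... v_d in G (d edges, d+1 vertices) whose edges have
   pairwise distinct directions (a geodesic walk). *)
Definition geodesic_walk n (VG : {set cube n}) (EG : {set {set cube n}})
  (d : nat) (t : (d.+1).-tuple (cube n)) : bool :=
  [&& all (fun x => x \in VG) t,
      [forall i : 'I_d, [set tnth t (widen_ord (leqnSn d) i); tnth t (lift ord0 i)] \in EG]
    & [forall i : 'I_d, forall j : 'I_d, (i < j) ==>
        (diffset (tnth t (widen_ord (leqnSn d) i)) (tnth t (lift ord0 i))
         != diffset (tnth t (widen_ord (leqnSn d) j)) (tnth t (lift ord0 j)))]].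

Definition path_subgraph n (d : nat) (t : (d.+1).-tuple (cube n))
  : {set cube n} * {set {set cube n}} :=
  ([set x in t],
   [set [set tnth t (widen_ord (leqnSn d) i); tnth t (lift ord0 i)] | i : 'I_d]).

(* Geodesics of length d in G, counted as subgraphs (so a path and its
   reversal are the same object). *)
Definition geodesics n (VG : {set cube n}) (EG : {set {set cube n}}) (d : nat)
  : {set {set cube n} * {set {set cube n}}} :=
  [set P | [exists t : (d.+1).-tuple (cube n),
              geodesic_walk VG EG t && (P == path_subgraph t)]].

(* Main.v *)
Require Import Defs.
From mathcomp Require Import all_boot all_fingroup zify.
Set Implicit Arguments. Unset Strict Implicit. Unset Printing Implicit Defensive.

(** For every ordering of the n directions, place a pedestrian on each vertex of G
    and scan the directions in that order, each pedestrian crossing the edge in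
    the current direction whenever G has it.  Every edge is crossed once each
    way, so the pedestrians make 2|E(G)| >= d|V(G)| steps altogether, and never
    two of them the same one; a route of c steps contains at least c - d + 1
    directed geodesics of length d whose directions increase in the given
    ordering, so each ordering yields at least |V(G)| of these.  A given
    directed geodesic is increasing for only n!/d! of the n! orderings, so
    there are at least d!|V(G)| directed geodesics, and each path carries at
    most two of them. *)

(** * Cube geodesics coded by a start and a list of directions *)

Definition flip n (x : cube n) (a : 'I_n) : cube n :=
  [ffun b => x b (+) (b == a)].

(** On a duplicate-free list this is the endpoint of the walk from [x] along [l]; intermediate
    vertices come from prefixes of [l]. *)
Definition flips n (x : cube n) (l : seq 'I_n) : cube n :=
  [ffun b => x b (+) (b \in l)].

Lemma flipK n (a : 'I_n) : involutive (fun x : cube n => flip x a).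
Proof. by move=> x; apply/ffunP=> b; rewrite !ffunE -addbA addbb addbF. Qed.

Lemma flip_neq n (x : cube n) a : x != flip x a.
Proof.
by apply/eqP=> /ffunP/(_ a); rewrite ffunE eqxx addbT; case: (x a).
Qed.

Lemma flips0 n (x : cube n) : flips x [::] = x.
Proof. by apply/ffunP=> b; rewrite ffunE addbF. Qed.

Lemma flips_cons n (x : cube n) a l :
  a \notin l -> flips x (a :: l) = flips (flip x a) l.
Proof.
move=> al; apply/ffunP=> b; rewrite !ffunE in_cons -addbA.
by case: eqP => //= ->; rewrite (negbTE al).
Qed.

Lemma qadj_flip n (u v : cube n) : qadj u v -> exists a, v = flip u a.
Proof.
case/cards1P=> a Ea; exists a; apply/ffunP=> b.
have := in_set1 b a; rewrite -Ea inE ffunE => <-.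
by case: (u b) (v b) => [] [].
Qed.

Lemma card_diffset_flips n (x : cube n) l i j :
  uniq l -> i <= j <= size l ->
  #|diffset (flips x (take i l)) (flips x (take j l))| = j - i.
Proof.
move=> Ul /andP[ij jl].
have Utj : uniq (take j l) by apply: take_uniq.
have E : take j l = take i l ++ drop i (take j l).
  by rewrite -{1}(cat_take_drop i (take j l)) take_takel.
have szd : size (drop i (take j l)) = j - i by rewrite size_drop size_takel.
have -> : diffset (flips x (take i l)) (flips x (take j l))
    = [set b in drop i (take j l)].
  apply/setP=> b; rewrite !inE !ffunE.
  rewrite {1}E mem_cat.
  move: Utj; rewrite {1}E cat_uniq => /and3P[_ /hasPn H _].
  case bt : (b \in take i l); case bd : (b \in drop _ _); case: (x b) => //.
    by move: (H b bd); rewrite /= bt.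
  by move: (H b bd); rewrite /= bt.
by rewrite cardsE -szd; apply/card_uniqP; apply: drop_uniq.
Qed.

Lemma diffset_flipsS n (x : cube n) l a0 i :
  uniq l -> i < size l ->
  diffset (flips x (take i l)) (flips x (take i.+1 l)) = [set nth a0 l i].
Proof.
move=> Ul il; apply/setP=> b; rewrite !inE !ffunE (take_nth a0) // mem_rcons.
rewrite in_cons; case: (b =P _) => [->|_] /=; last by rewrite eqxx.
have /negbTE-> : nth a0 l i \notin take i l.
  have := take_uniq i.+1 Ul; rewrite (take_nth a0) // rcons_uniq.
  by case/andP.
by case: (x _).
Qed.

Lemma diffsetC n (u v : cube n) : diffset u v = diffset v u.
Proof. by apply/setP=> b; rewrite !inE eq_sym. Qed.

Definition walk n d (x : cube n) (l : d.-tuple 'I_n) : d.+1.-tuple (cube n) :=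
  [tuple flips x (take j l) | j < d.+1].

(** With truncated subtraction one summand vanishes, so the right side is the distance between the
    two positions. *)
Lemma card_diffset_walk n d (x : cube n) (l : d.-tuple 'I_n) i j :
  uniq l ->
  #|diffset (tnth (walk x l) i) (tnth (walk x l) j)| = (i - j) + (j - i).
Proof.
move=> Ul; rewrite !tnth_mktuple.
have := ltn_ord i; have := ltn_ord j; rewrite !ltnS => jd id.
case/orP: (leq_total i j) => ij.
  by rewrite card_diffset_flips ?ij ?size_tuple //; lia.
by rewrite diffsetC card_diffset_flips ?ij ?size_tuple //; lia.
Qed.

Lemma tnth_walk0 n d (x : cube n) (l : d.-tuple 'I_n) :
  tnth (walk x l) ord0 = x.
Proof. by rewrite tnth_mktuple take0 flips0. Qed.

Lemma walk_inj n d (x : cube n) (l m : d.-tuple 'I_n) :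
  uniq l -> uniq m -> walk x l = walk x m -> l = m.
Proof.
move=> Ul Um E; apply: eq_from_tnth => i.
pose a0 := tnth l i.
have /(_ i) H j : flips x (take j l) = flips x (take j m).
  case: (ltnP j d.+1) => [jd|dj].
    by have := congr1 (fun t => tnth t (Ordinal jd)) E; rewrite !tnth_mktuple.
  have := congr1 (fun t => tnth t ord_max) E.
  by rewrite !tnth_mktuple /= !take_oversize ?size_tuple //; lia.
have H' : flips x (take i.+1 l) = flips x (take i.+1 m).
  by have := congr1 (fun t => tnth t (lift ord0 i)) E; rewrite !tnth_mktuple.
have id : i < d by [].
have := diffset_flipsS x a0 Ul; move=> /(_ i); rewrite size_tuple id => /(_ isT).
rewrite H H' (diffset_flipsS x a0) ?size_tuple //.
by move=> /set1_inj; rewrite -!tnth_nth.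
Qed.

Lemma mem_walk n d (x : cube n) (l : d.-tuple 'I_n) y :
  y \in walk x l -> exists i, y = tnth (walk x l) i.
Proof. by case/tnthP=> i ->; exists i. Qed.

(** The vertex at position [i] is the only one at distance [i] from the common start, so the vertex
    set alone fixes the order of the visits. *)
Lemma walk_same_vertices n d (x : cube n) (l m : d.-tuple 'I_n) :
  uniq l -> uniq m -> walk x l =i walk x m -> l = m.
Proof.
move=> Ul Um E; apply: (@walk_inj _ _ x) => //; apply: eq_from_tnth => i.
have /mem_walk[j Ej] : tnth (walk x l) i \in walk x m by rewrite -E mem_tnth.
have := card_diffset_walk x ord0 i Ul.
have := card_diffset_walk x ord0 j Um.
rewrite -Ej !tnth_walk0 !sub0n !subn0 !add0n => -> /val_inj ji.
by rewrite Ej ji.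
Qed.

(* Only the two ends of a geodesic are at distance d from some vertex of it. *)
Lemma walk_start n d (x y : cube n) (l m : d.-tuple 'I_n) :
  uniq l -> uniq m -> walk x l =i walk y m ->
  y \in [set x; tnth (walk x l) ord_max].
Proof.
move=> Ul Um E.
have /mem_walk[i Ei] : y \in walk x l by rewrite E -{1}(tnth_walk0 y m) mem_tnth.
have /mem_walk[j Ej] : tnth (walk y m) ord_max \in walk x l by rewrite E mem_tnth.
have := card_diffset_walk y ord0 ord_max Um.
rewrite Ej tnth_walk0 Ei (card_diffset_walk _ _ _ Ul) sub0n subn0 /= => H.
have := ltn_ord i; have := ltn_ord j => jd id.
have [i0|im] : i = ord0 \/ i = ord_max.
  have [?|?] : i = 0 :> nat \/ i = d :> nat by lia.
    by left; apply: val_inj.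
  by right; apply: val_inj.
- by rewrite i0 tnth_walk0 set21.
- by rewrite im set22.
Qed.

(** * Directed geodesics of the subgraph and the paths below them *)

Section Subgraph.

Variables (n : nat) (VG : {set cube n}) (EG : {set {set cube n}}).
Hypothesis subG : is_subgraph VG EG.

Definition has_edge (x : cube n) (a : 'I_n) := [set x; flip x a] \in EG.

Fixpoint follows (x : cube n) (l : seq 'I_n) : bool :=
  if l is a :: l' then has_edge x a && follows (flip x a) l' else true.

Lemma has_edge_flip x a : has_edge (flip x a) a = has_edge x a.
Proof. by rewrite /has_edge flipK setUC. Qed.

Lemma has_edge_vertex x a : has_edge x a -> x \in VG.
Proof.
case/subG=> u [v [uV vV _ E]].
have : x \in [set u; v] by rewrite -E set21.
by move=> /set2P [] ->.
Qed.

Lemma follows_edge x l i :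
  uniq l -> follows x l -> i < size l ->
  [set flips x (take i l); flips x (take i.+1 l)] \in EG.
Proof.
elim: l x i => [|a l IH] x [|i] //= /andP[al Ul] /andP[xa F] il.
  by rewrite take0 flips0 flips_cons // flips0.
have nt k : a \notin take k l by apply: contra al; apply: mem_take.
by rewrite !flips_cons //; apply: IH.
Qed.

Lemma follows_vertex x l i :
  uniq l -> x \in VG -> follows x l -> flips x (take i l) \in VG.
Proof.
elim: l x i => [|a l IH] x [|i] //=; rewrite ?flips0 //.
move=> /andP[al Ul] xV /andP[xa F].
rewrite flips_cons; last by apply: contra al; apply: mem_take.
by apply: IH => //; apply: (@has_edge_vertex _ a); rewrite has_edge_flip.
Qed.

Definition directed_geodesics d : {set cube n * d.-tuple 'I_n} :=
  [set p : cube n * d.-tuple 'I_n | [&& p.1 \in VG, uniq p.2 & follows p.1 p.2]].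

Lemma walk_geodesic d (p : cube n * d.-tuple 'I_n) :
  p \in directed_geodesics d -> geodesic_walk VG EG (walk p.1 p.2).
Proof.
case: p => x l; rewrite inE /= => /and3P[xV Ul F]; apply/and3P; split.
- by apply/allP=> y /mem_walk[i ->]; rewrite tnth_mktuple follows_vertex.
- apply/forallP=> i; rewrite !tnth_mktuple.
  by apply: follows_edge; rewrite // size_tuple (ltn_ord i).
- apply/forallP=> i; apply/forallP=> j; apply/implyP=> ij.
  rewrite !tnth_mktuple !(diffset_flipsS _ (tnth l i)) ?size_tuple
    ?(ltn_ord i) ?(ltn_ord j) //.
  apply/eqP=> /set1_inj/eqP; rewrite nth_uniq ?size_tuple
    ?(ltn_ord i) ?(ltn_ord j) //=.
  by rewrite (ltn_eqF ij).
Qed.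

(** All directed geodesics over one path share its vertex set. This set and the start determine the
    directions, and the start is one of the two ends. *)
Lemma card_directed_geodesics d :
  #|directed_geodesics d| <= 2 * #|geodesics VG EG d|.
Proof.
pose g (p : cube n * d.-tuple 'I_n) := path_subgraph (walk p.1 p.2).
rewrite -sum1_card (partition_big g (mem (geodesics VG EG d))) /=; last first.
  move=> p Hp; rewrite inE; apply/existsP; exists (walk p.1 p.2).
  by rewrite walk_geodesic //= eqxx.
rewrite mulnC -sum_nat_const; apply: leq_sum => P _.
rewrite sum1dep_card; set F := [set _ | _].
have [->|[p0 Fp0]] := set_0Vmem F; first by rewrite cards0.
have mem_g p q : g p = g q -> walk p.1 p.2 =i walk q.1 q.2.
  by case=> /setP E _ y; have := E y; rewrite !inE.
have FP p : p \in F -> uniq p.2 /\ g p = P.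
  by rewrite !inE => /andP[/and3P[_ -> _] /eqP].
have [U0 g0] := FP _ Fp0.
have inj1 : {in F &, injective (@fst (cube n) (d.-tuple 'I_n))}.
  move=> p q /FP[Up gp] /FP[Uq gq] pq.
  have := mem_g p q; rewrite gp gq => /(_ erefl).
  case: p q pq Up Uq {gp gq} => x l [y m] /= <- Ul Um E.
  by rewrite (walk_same_vertices Ul Um E).
rewrite -(card_in_imset inj1).
apply: leq_trans (_ : #|[set p0.1; tnth (walk p0.1 p0.2) ord_max]| <= 2).
  apply/subset_leq_card/subsetP=> y /imsetP[q /FP[Uq gq] ->].
  by apply: (@walk_start _ _ _ _ _ q.2) => //; apply: mem_g; rewrite g0.
by rewrite cards2; case: (_ != _).
Qed.

(** * Pedestrians scanning the directions in a fixed order *)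

(* The number of steps of the pedestrian starting at x who scans the
   directions in s in order and moves whenever G has the required edge. *)
Fixpoint greedy (s : seq 'I_n) (x : cube n) : nat :=
  if s is a :: s' then
    if has_edge x a then (greedy s' (flip x a)).+1 else greedy s' x
  else 0.

Definition walks_along (s : seq 'I_n) k (x : cube n) : {set k.-tuple 'I_n} :=
  [set l : k.-tuple 'I_n | subseq l s && follows x l].

(** The first [k] steps of the greedy route are a witness. *)
Lemma walks_along_greedy s k x :
  k <= greedy s x -> 0 < #|walks_along s k x|.
Proof.
move=> kg; suff [l szl /andP[ls xl]] :
    exists2 l : seq 'I_n, size l == k & subseq l s && follows x l.
  by apply/card_gt0P; exists (Tuple szl); rewrite inE /= ls.
elim: s k x kg => [|a s IH] [|k] x //=; try by exists [::].
case: ifP => [xa|_] kg; last first.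
  have [l szl /andP[ls xl]] := IH _ _ kg; exists l => //.
  by rewrite xl andbT; apply: subseq_trans ls (subseq_cons _ _).
have [l szl /andP[ls xl]] := IH _ _ kg; exists (a :: l) => //=.
by rewrite eqxx ls xa.
Qed.

(** The first term counts walks avoiding [a], the second those that begin with [a]; they are
    disjoint because [a] is not in [s]. *)
Lemma walks_along_cons a s k x :
  a \notin s ->
  #|walks_along s k.+1 x| + has_edge x a * #|walks_along s k (flip x a)|
    <= #|walks_along (a :: s) k.+1 x|.
Proof.
move=> as_.
have sub1 : walks_along s k.+1 x \subset walks_along (a :: s) k.+1 x.
  apply/subsetP=> l; rewrite !inE => /andP[ls ->]; rewrite andbT.
  by apply: subseq_trans ls (subseq_cons _ _).
case xa : (has_edge x a); last by rewrite mul0n addn0 subset_leq_card.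
pose c (l : k.-tuple 'I_n) : k.+1.-tuple 'I_n := [tuple of a :: l].
have cI : injective c by move=> l m /(congr1 val) [] /val_inj.
rewrite mul1n -(card_imset _ cI).
have D : [disjoint walks_along s k.+1 x & c @: walks_along s k (flip x a)].
  rewrite disjoint_sym; apply/pred0P=> l /=; apply/negP=> /andP[/imsetP[m _ ->]].
  rewrite inE => /andP[/mem_subseq/(_ a)]; rewrite mem_head => /(_ isT).
  by rewrite (negbTE as_).
have := (leq_card_setU (walks_along s k.+1 x) (c @: walks_along s k (flip x a))).2.
rewrite D => /eqP <-; apply: subset_leq_card; rewrite subUset sub1 /=.
apply/subsetP=> l /imsetP[m]; rewrite inE => /andP[ms xm] ->.
by rewrite inE /= eqxx ms xa.
Qed.

(** Pedestrians at the two ends of an [a]-edge swap places, so each vertex still carries one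
    pedestrian after [a] is scanned. *)
Lemma sum_flip_edges a (F : cube n -> nat) :
  \sum_(x | has_edge x a) F (flip x a) = \sum_(x | has_edge x a) F x.
Proof.
rewrite [RHS](reindex_inj (inv_inj (flipK a))) /=.
by apply: eq_bigl => x; rewrite has_edge_flip.
Qed.

Lemma sum_vertices_edges a (F : cube n -> nat) :
  \sum_(x in VG) F x =
  \sum_(x | has_edge x a) F x + \sum_(x in VG | ~~ has_edge x a) F x.
Proof.
rewrite (bigID (fun x => has_edge x a)) /=; congr (_ + _).
apply: eq_bigl => x; case xa : (has_edge x a); last by rewrite andbF.
by rewrite (has_edge_vertex xa).
Qed.

Lemma sum_greedy_cons a s (F : nat -> nat) :
  \sum_(x in VG) F (greedy (a :: s) x) =
  \sum_(x | has_edge x a) F (greedy s x).+1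
    + \sum_(x in VG | ~~ has_edge x a) F (greedy s x).
Proof.
rewrite (sum_vertices_edges a); congr (_ + _).
  rewrite -(sum_flip_edges a (fun x => F (greedy s x).+1)).
  by apply: eq_bigr => x /= ->.
by apply: eq_bigr => x /andP[_ /negbTE /= ->].
Qed.

Lemma sum_greedy s :
  \sum_(x in VG) greedy s x = \sum_(a <- s) #|[set x | has_edge x a]|.
Proof.
elim: s => [|a s IH]; first by rewrite big_nil big1.
rewrite (sum_greedy_cons a s id) big_cons -IH [X in _ = _ + X](sum_vertices_edges a).
rewrite addnA; congr (_ + _).
by rewrite -sum1dep_card -big_split; apply: eq_bigr => x _.
Qed.

(* A pedestrian making c steps traces c - k walks of length k.+1, and two
   pedestrians never make the same step. *)
Lemma sum_walks_along s k :
  uniq s ->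
  \sum_(x in VG) (greedy s x - k) <= \sum_(x in VG) #|walks_along s k.+1 x|.
Proof.
elim: s => [|a s IH]; first by rewrite big1.
move=> /= /andP[as_ Us].
rewrite (sum_greedy_cons a s (fun c => c - k)).
pose G x := #|walks_along s k.+1 x| + has_edge x a * #|walks_along s k (flip x a)|.
apply: leq_trans (_ : \sum_(x in VG) G x <= _); last first.
  by apply: leq_sum => x _; apply: walks_along_cons.
rewrite big_split /=.
have -> : \sum_(x in VG) has_edge x a * #|walks_along s k (flip x a)|
    = \sum_(x | has_edge x a) #|walks_along s k x|.
  rewrite (sum_vertices_edges a) [X in _ + X]big1 ?addn0; last first.
    by move=> x /andP[_ /negbTE->].
  rewrite -[RHS]sum_flip_edges.
  by apply: eq_bigr => x ->; rewrite mul1n.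
apply: leq_trans (leq_add (IH Us) (leqnn _)).
rewrite (sum_vertices_edges a (fun x => greedy s x - k)) addnAC leq_add2r.
rewrite -big_split; apply: leq_sum => x _ /=.
(* If [k <= greedy s x], the extra step raises the truncated difference by one, which is paid for by
   a walk of length [k] from [x]; otherwise the left side is 0. *)
have := @walks_along_greedy s k x; case: (leqP k (greedy s x)) => kg.
  by move=> /(_ isT) ?; rewrite subSn // -addn1 leq_add2l.
by lia.
Qed.

(** Each edge is seen from both of its ends, in its own direction. *)
Lemma card_edges_le :
  2 * #|EG| <= \sum_(a : 'I_n) #|[set x | has_edge x a]|.
Proof.
have -> : \sum_(a : 'I_n) #|[set x | has_edge x a]|
    = \sum_(p : 'I_n * cube n | has_edge p.2 p.1) 1.
  under eq_bigr => a _ do rewrite -sum1dep_card.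
  by rewrite pair_big_dep.
rewrite (partition_big (fun p => [set p.2; flip p.2 p.1]) (mem EG)) //=.
rewrite mulnC -sum_nat_const; apply: leq_sum => e eE.
rewrite sum1dep_card.
have [u [v [_ _ /qadj_flip[a ->] Ee]]] := subG eE.
apply: leq_trans (_ : #|[set (a, u); (a, flip u a)]| <= _).
  by rewrite cards2 xpair_eqE eqxx /= flip_neq.
apply/subset_leq_card/subsetP=> p /set2P[] ->; rewrite inE /= /has_edge.
  by rewrite -Ee eE eqxx.
by rewrite flipK setUC -Ee eE eqxx.
Qed.

Lemma card_walks_along_ordering s d :
  uniq s -> (forall a, a \in s) -> d * #|VG| <= 2 * #|EG| ->
  #|VG| <= \sum_(x in VG) #|walks_along s d x|.
Proof.
(* Length 0 is separate, since [sum_walks_along] speaks of length [k.+1] only; there the empty walk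
   serves each vertex. *)
move=> Us sT; case: d => [_|k dE].
  by rewrite -sum1_card; apply: leq_sum => x _; apply: walks_along_greedy.
apply: leq_trans (sum_walks_along k Us).
have : k.+1 * #|VG| <= \sum_(x in VG) greedy s x.
  rewrite sum_greedy; apply: leq_trans dE (leq_trans card_edges_le _).
  by rewrite [leqRHS]big_uniq //=; apply: eq_leq; apply: eq_bigl => a; rewrite sT.
have : \sum_(x in VG) greedy s x <= \sum_(x in VG) (k + (greedy s x - k)).
  by apply: leq_sum => x _; lia.
rewrite big_split /= sum_nat_const mulSn mulnC => le1 le2.
by rewrite -(leq_add2r (k * #|VG|)) [leqRHS]addnC (leq_trans le2).
Qed.

End Subgraph.

(** * Orderings in which a given list of directions is increasing *)

Section Orderings.

Variables (n d : nat).

(** The inverse is taken so that direction [a] stands at position [p a]. *)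
Definition ordering (p : 'S_n) : seq 'I_n := [seq (p^-1)%g i | i <- enum 'I_n].

Lemma ordering_uniq p : uniq (ordering p).
Proof. by rewrite map_inj_uniq ?enum_uniq //; apply: perm_inj. Qed.

Lemma mem_ordering p a : a \in ordering p.
Proof. by apply/mapP; exists (p a); rewrite ?mem_enum ?permK. Qed.

Lemma subseq_ordering p (l : d.-tuple 'I_n) :
  subseq l (ordering p) -> sorted ltn (map val (map_tuple p l)).
Proof.
have E : [seq p i | i <- ordering p] = enum 'I_n.
  by rewrite -map_comp map_id_in // => i _; apply: permKV.
move=> /(map_subseq p); rewrite E.
move=> /(map_subseq val); rewrite val_enum_ord => H.
by apply: (subseq_sorted ltn_trans H); apply: iota_ltn_sorted.
Qed.

(** Fix one such permutation [q]: composing any other with the inverse of [q] fixes the entries of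
    [l], leaving a permutation of the other [n - d] directions. *)
Lemma card_perm_map (l m : d.-tuple 'I_n) :
  uniq l -> #|[set p : 'S_n | map_tuple p l == m]| <= (n - d)`!.
Proof.
move=> Ul; set A := [set p | _].
have [->|[q]] := set_0Vmem A; first by rewrite cards0.
rewrite inE => /eqP qm.
have <- : #|~: [set a in l]| = n - d.
  by rewrite cardsCs setCK cardsE (card_uniqP Ul) size_tuple card_ord.
rewrite -card_perm -(card_imset _ (mulIg q^-1%g)).
apply/subset_leq_card/subsetP=> r /imsetP[p]; rewrite inE => /eqP pm ->.
rewrite unfold_in; apply/subsetP=> a; rewrite !inE; apply: contraNN => /tnthP[i ->].
have := congr1 (fun t => tnth t i) (etrans pm (esym qm)).
by rewrite !tnth_map permM => ->; rewrite permK.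
Qed.

(** The positions of [l] form an increasing tuple, with ['C(n, d)] choices. For [d <= n] the bound
    is n!/d!, written without division. *)
Lemma card_orderings_subseq (l : d.-tuple 'I_n) :
  uniq l -> #|[set p | subseq l (ordering p)]| <= 'C(n, d) * (n - d)`!.
Proof.
move=> Ul; rewrite -card_ltn_sorted_tuples.
pose Q := [set t : d.-tuple 'I_n | sorted ltn (map val t)].
rewrite -sum1_card (partition_big (fun p : 'S_n => map_tuple p l) (mem Q)) /=.
  rewrite -sum_nat_const; apply: leq_sum => m _.
  rewrite sum1dep_card; apply: leq_trans (card_perm_map m Ul).
  by apply/subset_leq_card/subsetP=> p; rewrite !inE => /andP[].
by move=> p; rewrite !inE; apply: subseq_ordering.
Qed.

End Orderings.

Theorem theorem5 (n d : nat) (VG : {set cube n}) (EG : {set {set cube n}}) :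
  is_subgraph VG EG ->
  VG != set0 ->
  d * #|VG| <= 2 * #|EG| ->
  d`! * #|VG| <= 2 * #|geodesics VG EG d|.
Proof.
move=> subG V0 dE; apply: leq_trans (card_directed_geodesics subG d).
set D := directed_geodesics _ _ _.
(* Double count the pairs of an ordering and a directed geodesic increasing in it. *)
have H : n`! * #|VG| <= #|D| * ('C(n, d) * (n - d)`!).
  apply: leq_trans (_ : \sum_(p : 'S_n) \sum_(q in D) subseq q.2 (ordering p) <= _).
    have <- : #|{: 'S_n}| = n`! by rewrite card_Sn.
    rewrite -sum_nat_const; apply: leq_sum => p _.
    apply: leq_trans (card_walks_along_ordering subG
      (ordering_uniq p) (mem_ordering p) dE) _.
    apply: eq_leq.
    under eq_bigr => x _ do rewrite -sum1dep_card.
    rewrite pair_big_dep -big_mkcondr /=; apply: eq_bigl => -[x l] /=.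
    rewrite !inE /=; case: (x \in VG) => //=.
    case ls : (subseq l _); rewrite ?andbF //= andbT.
    by rewrite (subseq_uniq ls (ordering_uniq p)).
  rewrite exchange_big /= -sum_nat_const; apply: leq_sum => -[x l].
  rewrite inE /= => /and3P[_ Ul _].
  by apply: leq_trans (card_orderings_subseq Ul); rewrite -big_mkcond sum1dep_card.
(* For [d > n] the binomial is 0, so [H] would make [VG] empty. *)
have [dn|nd] := leqP d n; last first.
  by move: H; rewrite bin_small // mul0n muln0 leqn0 muln_eq0 cards_eq0
    (negbTE V0) orbF -leqn0 leqNgt fact_gt0.
move: H; rewrite -(bin_fact dn) mulnCA mulnAC leq_pmul2r //.
by rewrite muln_gt0 bin_gt0 dn fact_gt0.
Qed.
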